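(* There is an absolute constant $C$ such that the following holds. Let $G$ be a graph with maximum degree $\Delta$, and let $f>1$ be real. Suppose that for every vertex $u$ of $G$ there are at most $\Delta^4/f$ pairs of vertices $v,w$ with $d(u,v)=d(u,w)=d(v,w)=2$. Then \[ \tau_2(G)\le \chi(G)\left(1+\frac{C\Delta}{\sqrt{\log f}}\right). \]
   Context: $d(u,v)$ denotes graph distance in $G$ and $\chi(G)$ its chromatic number. A $2$-tone coloring of a graph $G$ assigns to each vertex $v$ a set of exactly $2$ colors from a color set $C'$ such that adjacent vertices share no color and vertices at distance $2$ share at most one color; $\tau_2(G)$ is the minimum $|C'|$ over all $2$-tone colorings of $G$.
   Formalization: The formal theorem additionally assumes log f ≤ Δ²; without such a bound the claim is false, e.g. for K_2, where no vertices are at distance 2, so f may tend to infinity while τ₂ = 4 and χ = 2. *)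

(* Defs.v *)
From mathcomp Require Import all_boot.

Set Implicit Arguments.
Unset Strict Implicit.
Unset Printing Implicit Defensive.

Record sgraph := SGraph {
  vertex :> finType;
  adj : rel vertex;
  adj_sym : symmetric adj;
  adj_irr : irreflexive adj }.

Definition max_degree (G : sgraph) : nat :=
  \max_(v : G) #|[set w : G | adj v w]|.

Definition has_walk (G : sgraph) (k : nat) (u v : G) : bool :=
  [exists p : k.-tuple G, path (@adj G) u p && (last u p == v)].

(* The least length of a walk from u to v; None stands for infinite distance.
   Shortest walks repeat no vertex, so lengths below #|G| suffice. *)
Definition gdist (G : sgraph) (u v : G) : option nat :=
  ohead [seq k <- iota 0 #|G| | has_walk k u v].

Definition proper_coloring (G : sgraph) (k : nat) (c : {ffun G -> 'I_k}) :=
  [forall u, forall v, adj u v ==> (c u != c v)].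

Definition colorable (G : sgraph) (k : nat) : bool :=
  [exists c : {ffun G -> 'I_k}, proper_coloring c].

Lemma colorable_exists (G : sgraph) : exists k, colorable G k.
Proof.
exists #|G|; apply/existsP; exists [ffun v => enum_rank v].
apply/forallP=> u; apply/forallP=> v; apply/implyP=> uv; rewrite !ffunE.
by apply: contraTneq uv => /enum_rank_inj->; rewrite adj_irr.
Qed.

Definition chromatic_number (G : sgraph) : nat := ex_minn (colorable_exists G).

Definition two_tone_coloring (G : sgraph) (k : nat)
    (c : {ffun G -> {set 'I_k}}) : bool :=
  [&& [forall v, #|c v| == 2],
      [forall u, forall v, adj u v ==> [disjoint c u & c v]] &
      [forall u, forall v, (gdist u v == Some 2) ==> (#|c u :&: c v| <= 1)]].

Definition two_tone_colorable (G : sgraph) (k : nat) : bool :=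
  [exists c : {ffun G -> {set 'I_k}}, two_tone_coloring c].

Lemma gdistxx (G : sgraph) (u : G) : gdist u u = Some 0.
Proof.
rewrite /gdist; have: 0 < #|G| by apply/card_gt0P; exists u.
case: #|G| => //= n _.
suff -> : has_walk 0 u u by [].
by apply/existsP; exists [tuple]; rewrite /= eqxx.
Qed.

Lemma two_tone_colorable_exists (G : sgraph) :
  exists k, two_tone_colorable G k.
Proof.
exists (#|G| + #|G|); apply/existsP.
exists [ffun v : G => [set lshift #|G| (enum_rank v); rshift #|G| (enum_rank v)]].
have disj (u v : G) : u != v ->
    [disjoint [set lshift #|G| (enum_rank u); rshift #|G| (enum_rank u)]
            & [set lshift #|G| (enum_rank v); rshift #|G| (enum_rank v)]].
  move=> uv; rewrite -setI_eq0; apply/eqP/setP=> x; rewrite !inE.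
  apply/negP => /andP[/orP[]/eqP-> /orP[]];
    rewrite ?eq_lshift ?eq_rshift ?eq_lrshift ?eq_rlshift //;
    by rewrite (inj_eq enum_rank_inj) (negPf uv).
apply/and3P; split.
- by apply/forallP=> v; rewrite ffunE cards2 eq_lrshift.
- apply/forallP=> u; apply/forallP=> v; apply/implyP=> uv; rewrite !ffunE.
  by apply: disj; apply: contraTneq uv => ->; rewrite adj_irr.
- apply/forallP=> u; apply/forallP=> v; apply/implyP=> uv; rewrite !ffunE.
  have /disj : u != v by apply: contraTneq uv => ->; rewrite gdistxx.
  by rewrite -setI_eq0 => /eqP->; rewrite cards0.
Qed.

Definition tau2 (G : sgraph) : nat := ex_minn (two_tone_colorable_exists G).

(* The unordered pairs {v, w} with d(u,v) = d(u,w) = d(v,w) = 2. *)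
Definition dist2_pairs (G : sgraph) (u : G) : {set {set G}} :=
  [set S : {set G} | [exists v, exists w,
    [&& S == [set v; w], gdist u v == Some 2, gdist u w == Some 2
      & gdist v w == Some 2]]].

(* Main.v *)
(** The vertices at distance 2 form a graph [H] with maximum degree at most
    [D = Delta^2] in which every neighbourhood spans at most [D^2 / f] edges.
    If [H] has a proper colouring with ['C(m, 2)] colours, then encoding these
    colours as pairs and giving each class of an optimal colouring of [G] its
    own palette of [m] tones yields [tau2 G <= chi(G) * m].

    For [f <= Delta^4], [H] is coloured with [O(D / log f)] colours by a counting
    argument in the style of Rosenfeld.  Colours are pairs (part, shade).  One
    shows by induction that adding a vertex [v] to a partial domain multiplies
    the number of proper colourings by at least [lam]: in a uniformly random
    proper colouring, reveal everything except the shades of those neighbours of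
    [v] that share their part with no adjacent neighbour of [v].  These shades
    are independent, and the induction hypothesis bounds the expected number of
    neighbours of [v] that are not freely resampled, so that on average at least
    [lam] colours stay available at [v].

    For [f > Delta^4] there are no three vertices pairwise at distance 2, hence
    [Delta <= 2 * chi(G)], and a greedy colouring with [5 * Delta] tones is good
    enough. *)

Require Import Defs.
From mathcomp Require Import all_boot all_order all_algebra.
From mathcomp Require Import reals sequences exp.
From mathcomp Require Import zify ring lra.

Set Implicit Arguments.
Unset Strict Implicit.
Unset Printing Implicit Defensive.

Import Order.TTheory GRing.Theory Num.Theory.

(** * Distance two and two-tone colourings *)

Lemma card_bigcup_le (I T : finType) (P : pred I) (A : I -> {set T}) (m : nat) :
  (forall i, P i -> #|A i| <= m) -> #|\bigcup_(i | P i) A i| <= #|P| * m.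
Proof.
move=> Am; rewrite -sum_nat_const.
elim/big_rec2: _ => [|i B n Pi le]; first by rewrite cards0.
by apply: leq_trans (leq_card_setU _ _) _; rewrite leq_add ?Am.
Qed.

Section Distance2.
Variable G : sgraph.
Implicit Types u v w : G.

Lemma has_walk0 u v : has_walk 0 u v = (u == v).
Proof.
apply/existsP/idP => [[p]|uv]; first by rewrite tuple0 /=.
by exists [tuple]; rewrite /= uv.
Qed.

Lemma has_walk1 u v : has_walk 1 u v = adj u v.
Proof.
apply/existsP/idP => [[p]|uv].
  by case/tupleP: p => x p; rewrite tuple0 /= andbT => /andP[? /eqP<-].
by exists [tuple v]; rewrite /= uv eqxx.
Qed.

Lemma has_walk2 u v : has_walk 2 u v = [exists x, adj u x && adj x v].
Proof.
apply/existsP/existsP => [[p]|[x /andP[ux xv]]].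
  case/tupleP: p => x p; case/tupleP: p => y p; rewrite tuple0 /= andbT.
  by move=> /andP[/andP[ux xy] /eqP<-]; exists x; rewrite ux.
by exists [tuple x; v]; rewrite /= ux xv eqxx.
Qed.

Lemma gdist_eq2 u v : (gdist u v == Some 2) =
  [&& u != v, ~~ adj u v & [exists x, adj u x && adj x v]].
Proof.
rewrite -has_walk0 -has_walk1 -has_walk2 /gdist.
(* [gdist] tries only lengths below [#|G|], so it misses length 2 when [#|G| <= 2]; but then [u],
   [x], [v] would be three distinct vertices. *)
have small : #|G| <= 2 -> [&& ~~ has_walk 0 u v, ~~ has_walk 1 u v & has_walk 2 u v] = false.
  move=> le2; apply/negP => /and3P[]; rewrite has_walk0 has_walk1 has_walk2.
  move=> uv _ /existsP[x /andP[ux xv]].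
  have: uniq [:: u; x; v].
    rewrite /= !inE negb_or uv !andbT; apply/andP; split.
      by apply: contraTneq ux => ->; rewrite adj_irr.
    by apply: contraTneq xv => ->; rewrite adj_irr.
  move=> /card_uniqP /= E; have := max_card (mem [:: u; x; v]); rewrite E; lia.
case: #|G| small => [|[|[|n]]] /= small.
- by rewrite small.
- by rewrite small //; case: (has_walk 0 u v).
- by rewrite small //; case: (has_walk 0 u v); case: (has_walk 1 u v).
case: (has_walk 0 u v) => //; case: (has_walk 1 u v) => //.
case: (has_walk 2 u v) => //=; apply/negP => /eqP E.
have: 2 \in [seq k <- iota 3 n | has_walk k u v].
  by case: [seq _ <- _ | _] E => //= a s [->]; rewrite mem_head.
by rewrite mem_filter mem_iota andbF.
Qed.

Lemma gdist2_sym : symmetric (fun u v => gdist u v == Some 2).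
Proof.
move=> u v; rewrite !gdist_eq2 eq_sym adj_sym; do 2!congr (_ && _).
by apply: eq_existsb => x; rewrite adj_sym andbC adj_sym.
Qed.

Lemma degree_le_max u : #|[set w | adj u w]| <= max_degree G.
Proof. exact: (leq_bigmax (F := fun v : G => #|[set w | adj v w]|)). Qed.

Lemma card_gdist2_le u : #|[set w | gdist u w == Some 2]| <= max_degree G ^ 2.
Proof.
have sub : [set w | gdist u w == Some 2] \subset
    \bigcup_(x in [set x | adj u x]) [set w | adj x w].
  apply/subsetP => w; rewrite inE gdist_eq2 => /and3P[_ _ /existsP[x /andP[ux xw]]].
  by apply/bigcupP; exists x; rewrite inE.
apply: leq_trans (subset_leq_card sub) _.
apply: leq_trans (card_bigcup_le (m := max_degree G) _) _.
  by move=> x _; apply: degree_le_max.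
by rewrite -mulnn leq_mul2r degree_le_max orbT.
Qed.

(** Each unordered pair arises from at most two ordered ones. The left side is the form in which
    [locally_sparse_coloring] takes local sparsity. *)
Lemma card_dist2_ordered_pairs u :
  \sum_(v | gdist u v == Some 2)
     #|[set w | (gdist u w == Some 2) && (gdist v w == Some 2)]|
  <= 2 * #|dist2_pairs u|.
Proof.
pose A := [set p : G * G | [&& gdist u p.1 == Some 2, gdist u p.2 == Some 2
  & gdist p.1 p.2 == Some 2]].
have -> : \sum_(v | gdist u v == Some 2)
     #|[set w | (gdist u w == Some 2) && (gdist v w == Some 2)]| = #|A|.
  rewrite -sum1_card (eq_bigr (fun v : G =>
    \sum_(w | (gdist u w == Some 2) && (gdist v w == Some 2)) 1)); last first.
    by move=> v _; rewrite -sum1_card; apply: eq_bigl => w; rewrite inE.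
  by rewrite pair_big_dep; apply: eq_bigl => p; rewrite !inE.
pose h (p : G * G) := [set p.1; p.2].
rewrite -sum1_card (partition_big h (mem (dist2_pairs u))) /=; last first.
  move=> [v w]; rewrite !inE /= => H; apply/existsP; exists v.
  by apply/existsP; exists w; rewrite eqxx.
rewrite mulnC -sum_nat_const; apply: leq_sum => B.
rewrite inE => /existsP[v /existsP[w /and4P[/eqP-> _ _ _]]].
have sub : [set p in A | h p == [set v; w]] \subset [set (v, w); (w, v)].
  apply/subsetP => -[a b]; rewrite !inE !xpair_eqE /= => /andP[/and3P[_ _ ab] /eqP E].
  have nab : a != b by move: ab; rewrite gdist_eq2 => /andP[].
  have : a \in [set v; w] by rewrite -E /h !inE eqxx.
  have : b \in [set v; w] by rewrite -E /h !inE eqxx orbT.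
  by rewrite !inE => /orP[]/eqP ? /orP[]/eqP ?; subst; rewrite ?eqxx ?orbT // ?eqxx in nab *.
have := subset_leq_card sub; rewrite cards2 -sum1_card => H.
rewrite (eq_bigl (fun p => p \in [set p in A | h p == [set v; w]])).
  by apply: leq_trans H _; case: (_ != _).
by move=> p; rewrite !inE.
Qed.

End Distance2.

(** Vertices are treated one by one along [enum V]. As [ext] copes with every [g], arbitrary values
    at untreated vertices do no harm. *)
Lemma greedy_assignment (V : finType) (X : Type) (x0 : X)
    (conf : V -> V -> X -> X -> bool) :
  (forall u v x y, conf u v x y = conf v u y x) ->
  (forall (g : V -> X) v, exists x, forall u, u != v -> ~~ conf v u x (g u)) ->
  exists g : V -> X, forall u v, u != v -> ~~ conf u v (g u) (g v).
Proof.
move=> symc ext.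
suff [g gP] : exists g : V -> X, {in enum V &, forall u v, u != v ->
    ~~ conf u v (g u) (g v)}.
  by exists g => u v; apply: gP; rewrite mem_enum.
elim: (enum V) => [|a s [g IH]]; first by exists (fun=> x0).
have [x xP] := ext g a.
exists (fun u => if u == a then x else g u) => u v; rewrite !inE.
case: eqVneq => [->|ua]; case: eqVneq => [->|va] /=; rewrite ?eqxx //.
- by move=> _ _ _; apply: xP.
- by move=> _ _ _; rewrite symc; apply: xP.
- exact: IH.
Qed.

(** * Two-tone colourings from degrees and from palettes *)

Section TwoTone.
Variable G : sgraph.

Lemma card2_setI_le1 (K : finType) (A B : {set K}) :
  #|A| = 2 -> #|B| = 2 -> A != B -> #|A :&: B| <= 1.
Proof.
move=> A2 B2; apply: contraNT; rewrite -ltnNge => I2.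
have AI : A :&: B == A by rewrite eqEcard subsetIl A2.
have BI : A :&: B == B by rewrite eqEcard subsetIr B2.
by rewrite -{1}(eqP AI) BI.
Qed.

(** Distinct sets of size 2 meet in at most one element, so distinctness suffices at distance 2. *)
Lemma tau2_le_card (K : finType) (c : G -> {set K}) :
  (forall v, #|c v| = 2) ->
  (forall u v, adj u v -> [disjoint c u & c v]) ->
  (forall u v, gdist u v == Some 2 -> c u != c v) -> tau2 G <= #|K|.
Proof.
move=> c2 cadj cdist; rewrite /tau2; case: ex_minnP => m _; apply.
apply/existsP; exists [ffun v => enum_rank @: c v]; apply/and3P; split.
- by apply/forallP => v; rewrite ffunE card_imset ?c2 //; exact: enum_rank_inj.
- apply/forallP => u; apply/forallP => v; apply/implyP => /cadj; rewrite !ffunE.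
  by rewrite -!setI_eq0 -imsetI ?imset_eq0 //; move=> ? ? _ _; exact: enum_rank_inj.
- apply/forallP => u; apply/forallP => v; apply/implyP => /cdist; rewrite !ffunE => ne.
  rewrite -imsetI; last by move=> ? ? _ _; exact: enum_rank_inj.
  by rewrite card_imset; [exact: card2_setI_le1 | exact: enum_rank_inj].
Qed.

Lemma tau2_le_max_degree : 0 < max_degree G -> tau2 G <= 5 * max_degree G.
Proof.
set d := max_degree G => d0.
pose X := {A : {set 'I_(5 * d)} | #|A| == 2}.
have ext (F : {set 'I_(5 * d)}) (B : {set {set 'I_(5 * d)}}) :
    #|F| <= 2 * d -> #|B| <= d ^ 2 ->
    exists x : X, [disjoint sval x & F] && (sval x \notin B).
  move=> F2 Bd.
  pose P := [set A : {set 'I_(5 * d)} | A \subset ~: F & #|A| == 2].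
  have [A] : exists A, A \in P :\: B.
    apply/card_gt0P; rewrite cardsD subn_gt0.
    apply: leq_ltn_trans (subset_leq_card (subsetIr _ _)) _.
    apply: leq_ltn_trans Bd _; rewrite cards_draws.
    have F3 : 3 * d <= #|~: F| by have := cardsC F; rewrite card_ord; lia.
    apply: leq_trans (leq_bin2l 2 F3); rewrite bin2; nia.
  rewrite !inE => /and3P[AB AF A2].
  by exists (exist _ A A2); rewrite /= AB disjoints_subset AF.
pose conf (u v : G) (x y : X) := (adj u v && ~~ [disjoint sval x & sval y])
  || ((gdist u v == Some 2) && (sval x == sval y)).
have [x0 _] : exists x : X, [disjoint sval x & set0] && (sval x \notin set0).
  by apply: ext; rewrite cards0.
have [||g gP] := @greedy_assignment G X x0 conf.
- move=> u v x y; rewrite /conf adj_sym disjoint_sym [sval x == _]eq_sym.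
  by rewrite [_ == Some 2]gdist2_sym.
- move=> g v.
  have [||x /andP[xF xB]] := ext (\bigcup_(u in [set u | adj v u]) sval (g u))
     [set sval (g u) | u in [set u | gdist v u == Some 2]].
  + apply: leq_trans (card_bigcup_le (m := 2) _) _.
      by move=> u _; rewrite (eqP (svalP (g u))).
    by rewrite mulnC leq_mul2l /= degree_le_max.
  + by apply: leq_trans (leq_imset_card _ _) _; apply: card_gdist2_le.
  exists x => u uv; rewrite negb_or !negb_and negbK; apply/andP; split.
    case avu : (adj v u) => //=; move: xF; rewrite disjoint_sym => xF.
    rewrite disjoint_sym; apply: disjointWl xF.
    by apply: (bigcup_sup u); rewrite inE.
  case dvu : (gdist v u == Some 2) => //=; apply: contra xB => /eqP->.
  by apply: imset_f; rewrite inE.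
rewrite -[5 * d]card_ord; apply: (@tau2_le_card _ (fun v => sval (g v))).
- by move=> v; apply/eqP/(svalP (g v)).
- move=> u v uv; have: u != v by apply: contraTneq uv => ->; rewrite adj_irr.
  by move=> /gP; rewrite /conf uv negb_or negbK => /andP[].
- move=> u v uv; have: u != v by move: uv; rewrite gdist_eq2 => /andP[].
  by move=> /gP; rewrite /conf uv negb_or => /andP[].
Qed.

Lemma chromatic_numberP :
  exists c : G -> 'I_(chromatic_number G), forall u v, adj u v -> c u != c v.
Proof.
rewrite /chromatic_number; case: ex_minnP => m /existsP[c /forallP cP] _.
by exists c => u v uv; have /forallP/(_ v)/implyP := cP u; apply.
Qed.

Lemma tau2_le_chromatic_mul (X : finType) (h : G -> X) (m : nat) :
  (forall u v, gdist u v == Some 2 -> h u != h v) -> #|X| <= 'C(m, 2) ->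
  tau2 G <= chromatic_number G * m.
Proof.
move=> hP Xm; have [c cP] := chromatic_numberP.
pose P := [set A : {set 'I_m} | #|A| == 2].
have PC : #|P| = 'C(m, 2) by rewrite card_draws card_ord.
(* The default [set0] is never returned, since [#|X|] is at most the number of pairs in [P]. *)
pose b (x : X) := nth set0 (enum P) (enum_rank x).
have ltb (x : X) : enum_rank x < size (enum P).
  by rewrite -cardE PC; apply: leq_trans Xm.
have b2 x : #|b x| = 2.
  by have := mem_nth set0 (ltb x); rewrite mem_enum inE => /eqP.
have binj : injective b.
  move=> x y /eqP; rewrite nth_uniq ?enum_uniq // => /eqP/val_inj.
  exact: enum_rank_inj.
have -> : chromatic_number G * m = #|{: 'I_(chromatic_number G) * 'I_m}|.
  by rewrite card_prod !card_ord.
apply: (@tau2_le_card _ (fun v => setX [set c v] (b (h v)))).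
- by move=> v; rewrite cardsX cards1 b2.
- move=> u v /cP uv; rewrite -setI_eq0; apply/eqP/setP => -[i j]; rewrite !inE /=.
  apply/negP => /andP[/andP[/eqP iu _] /andP[/eqP iv _]].
  by rewrite -iu -iv eqxx in uv.
- move=> u v /hP; apply: contra => /eqP/setP E; apply/eqP/binj/eqP.
  rewrite eqEcard !b2 andbT; apply/subsetP => j ju.
  by have := E (c u, j); rewrite !in_setX ju !inE eqxx /= => /esym/andP[].
Qed.

(* With no three vertices pairwise at distance 2, a colour class meets every
   neighbourhood in at most two vertices. *)
Lemma max_degree_le_chromatic :
  0 < max_degree G -> (forall u : G, dist2_pairs u = set0) ->
  max_degree G <= 2 * chromatic_number G.
Proof.
move=> d0 no; have [c cP] := chromatic_numberP.
have G0 : 0 < #|G|.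
  rewrite lt0n; apply: contraTneq d0 => G0; rewrite -leqNgt /max_degree big_pred0 //.
  by move=> x; have := fintype0 x G0.
have [v dv] := bigop.eq_bigmax (fun v : G => #|[set w | adj v w]|) G0.
rewrite /max_degree dv -sum1_card (partition_big c predT) //=.
rewrite -[X in 2 * X]card_ord mulnC -sum_nat_const; apply: leq_sum => i _.
rewrite sum1_card leqNgt; apply/negP => /card_gt2P[x [y [z [[]]]]].
rewrite -!topredE /= !inE => /andP[vx /eqP cx] /andP[vy /eqP cy] /andP[vz /eqP cz] [xy yz zx].
(* Equally coloured neighbours of [v] are non-adjacent and joined through [v]. *)
have d2 a b : adj v a -> adj v b -> c a = c b -> a != b -> gdist a b == Some 2.
  move=> va vb ab nab; rewrite gdist_eq2 nab /=; apply/andP; split.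
    by apply/negP => /cP; rewrite ab eqxx.
  by apply/existsP; exists v; rewrite adj_sym va.
have: [set y; z] \in dist2_pairs x.
  rewrite inE; apply/existsP; exists y; apply/existsP; exists z.
  by rewrite eqxx !d2 ?cx ?cy ?cz // eq_sym.
by rewrite no inE.
Qed.

End TwoTone.

(** * Averages over resampled colourings *)

Section Averaging.
Variable R : realType.
Local Open Scope ring_scope.

(** The classes partition [A]: this is the law of total expectation for a uniform element of [A]
    conditioned on its class. *)
Lemma sum_class_average (T : finType) (A : {set T}) (cl : T -> {set T})
    (h : T -> R) :
  (forall x, x \in A -> x \in cl x) ->
  (forall x y, x \in A -> y \in cl x -> y \in A /\ cl y = cl x) ->
  \sum_(x in A) h x = \sum_(x in A) (\sum_(y in cl x) h y) / #|cl x|%:R.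
Proof.
move=> cl_refl cl_eq; symmetry.
transitivity (\sum_(x in A) \sum_(y in cl x) h y / #|cl y|%:R).
  apply: eq_bigr => x xA; rewrite mulr_suml; apply: eq_bigr => y yx.
  by have [_ ->] := cl_eq x y xA yx.
rewrite (exchange_big_dep (mem A)) /=; last by move=> x y xA /(cl_eq x y xA)[].
apply: eq_bigr => y yA.
rewrite (eq_bigl (mem (cl y))) => [|x].
  rewrite sumr_const -[LHS]mulr_natr divfK // pnatr_eq0 -lt0n.
  by apply/card_gt0P; exists y; apply: cl_refl.
apply/andP/idP => [[xA yx]|xy].
  by have [_ ->] := cl_eq x y xA yx; apply: cl_refl.
by have [xA E] := cl_eq y x yA xy; rewrite E cl_refl.
Qed.

(** This follows from [expR (2 * t) >= 1 + 2 * t], because the product of [1 - t] and [1 + 2 * t] is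
    at least 1 on this range. *)
Lemma expRN2_le (t : R) : 0 <= t -> t <= 2^-1 -> expR (- (2 * t)) <= 1 - t.
Proof.
move=> t0 t2; rewrite expRN -[X in X <= _]mul1r ler_pdivrMr ?expR_gt0 //.
apply: (@le_trans _ _ ((1 - t) * (1 + 2 * t))).
  have -> : (1 - t) * (1 + 2 * t) = 1 + t * (1 - 2 * t) by ring.
  by rewrite lerDl mulr_ge0 //; lra.
by apply: ler_wpM2l; [lra | exact: expR_ge1Dx].
Qed.

(* Every factor [1 - 1/#|F u|] with [#|F u| >= 2] is at least
   [expR (- 2 / #|F u|)]; the exponents sum to at most [2 * #|N|] over all
   colours, and the tangent to [expR] at [- th] makes the bound linear in the
   number of colours blocked by the singletons. *)
Lemma family_avoid_average (V X : finType) (N : {set V}) (F : V -> {set X})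
    (th : R) : 0 <= th -> (forall u, (0 < #|F u|)%N) ->
  expR (- th) * ((#|X|%:R - #|[set u in N | (#|F u| <= 1)%N]|%:R) * (1 + th)
                 - 2 * #|N|%:R)
  <= (\sum_(psi in family F) #|[set c | [forall u in N, psi u != c]]|%:R)
     / #|family F|%:R.
Proof.
move=> th0 F0; set B := [set u in N | _].
have FN0 u : #|F u|%:R != 0 :> R by rewrite pnatr_eq0 -lt0n.
(* The factors [g] write the event that [psi] avoids [c] on [N] as a product over all vertices, so
   that its sum over the family factorises. *)
pose g (c : X) u (x : X) : R := if u \in N then (x != c)%:R else 1.
pose t c u : R := (c \in F u)%:R / #|F u|%:R.
pose a c := \sum_(u in N) t c u.
have t0 c u : 0 <= t c u by rewrite divr_ge0.
have cardF : #|family F|%:R = \prod_u #|F u|%:R :> R.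
  rewrite (eq_bigr (fun u => \sum_(x in F u) 1)).
    rewrite (bigA_distr_big_dep (fun u x => x \in F u)) /=.
    by rewrite -sum1_card natr_sum; apply: eq_bigr => psi _; rewrite big1.
  by move=> u _; rewrite sumr_const.
have -> : (\sum_(psi in family F) #|[set c | [forall u in N, psi u != c]]|%:R)
     / #|family F|%:R
   = \sum_c \prod_(u in N) (1 - t c u) :> R.
  rewrite (eq_bigr (fun psi : {ffun V -> X} => \sum_c \prod_u g c u (psi u))).
    rewrite exchange_big mulr_suml; apply: eq_bigr => c _ /=.
    rewrite -(bigA_distr_big_dep (fun u x => x \in F u)) /= cardF.
    rewrite -prodf_div [RHS]big_mkcond; apply: eq_bigr => u _ /=.
    rewrite /g; case: ifP => uN; last by rewrite sumr_const divff.
    have -> : \sum_(x in F u) (x != c)%:R = #|F u|%:R - (c \in F u)%:R :> R.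
      rewrite (eq_bigr (fun x => 1 - (x == c)%:R)) => [|x _].
        rewrite sumrB sumr_const; congr (_ - _).
        case: (boolP (c \in F u)) => cF.
          rewrite (bigD1 c) //= eqxx big1 ?addr0 // => x /andP[_ /negPf->] //.
        by apply: big1 => x xF; case: eqP => // xc; rewrite -xc xF in cF.
      by case: (x == c); rewrite /= ?subrr ?subr0.
    by rewrite /t mulrBl divff.
  move=> psi _; rewrite -sum1_card natr_sum big_mkcond; apply: eq_bigr => c _.
  rewrite inE /g; case: (boolP [forall u in N, _]) => [/forall_inP H|].
    by rewrite big1 // => u _; case: ifP => // /H ->.
  rewrite negb_forall_in => /existsP[u /andP[uN /negPn E]].
  by rewrite (bigD1 u) //= uN E mul0r.
(* Colours in [K] may be blocked with certainty; only nonnegativity of their terms is used, and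
   there are at most [#|B|] of them. *)
pose K := \bigcup_(u in B) F u.
have KB : (#|K| <= #|B|)%N.
  rewrite -[#|B|]muln1; apply: card_bigcup_le => u.
  by rewrite inE => /andP[].
have suma : \sum_c a c = #|N|%:R.
  rewrite /a exchange_big /= -sum1_card natr_sum; apply: eq_bigr => u _.
  rewrite -mulr_suml -natr_sum; rewrite (_ : (\sum_c _)%N = #|F u|) ?divff //.
  by rewrite -sum1_card [RHS]big_mkcond; apply: eq_bigr => c _; case: (c \in _).
have a0 c : 0 <= a c by apply: sumr_ge0.
have prod0 c : 0 <= \prod_(u in N) (1 - t c u).
  apply: prodr_ge0 => u _; rewrite subr_ge0 ler_pdivrMr ?ltr0n // mul1r ler_nat.
  by apply: leq_trans (F0 u); apply: leq_b1.
have good c : c \notin K ->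
    expR (- th) * (1 + th - 2 * a c) <= \prod_(u in N) (1 - t c u).
  move=> cK; apply: (@le_trans _ _ (expR (- (2 * a c)))).
    rewrite [X in _ <= expR X](_ : _ = - th + (th - 2 * a c)); last by ring.
    rewrite expRD ler_wpM2l ?expR_ge0 //.
    by rewrite -addrA; exact: expR_ge1Dx.
  rewrite /a mulr_sumr -sumrN expR_sum; apply: ler_prod => u uN.
  rewrite expR_ge0 /=; apply: expRN2_le => //.
  rewrite /t; case: (boolP (c \in F u)) => cF; last by rewrite mul0r invr_ge0.
  rewrite mul1r lef_pV2 ?posrE ?ltr0n // (ler_nat R 2) ltnNge.
  apply: contra cK => F1; apply/bigcupP; exists u => //.
  by rewrite inE uN.
rewrite (bigID (mem K)) /=.
apply: (@le_trans _ _ (\sum_(c | c \notin K) expR (- th) * (1 + th - 2 * a c))).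
  rewrite -mulr_sumr ler_wpM2l ?expR_ge0 // sumrB sumr_const -[(1 + th) *+ _]mulr_natl.
  rewrite -mulr_sumr.
  apply: lerB.
    rewrite ler_wpM2r ?addr_ge0 //.
    have -> : #|[pred c | c \notin K]|%:R = #|X|%:R - #|K|%:R :> R.
      by rewrite -[#|X|](cardC (mem K)) natrD addrC addKr.
    by rewrite lerD2l lerN2 ler_nat.
  rewrite ler_pM2l // -suma [leRHS](bigID (mem K)) /= lerDr.
  by apply: sumr_ge0.
apply: (@le_trans _ _ (\sum_(c | c \notin K) \prod_(u in N) (1 - t c u))).
  by apply: ler_sum => c; apply: good.
by rewrite lerDr; apply: sumr_ge0.
Qed.

End Averaging.

(** * Counting colourings of locally sparse graphs *)

Definition ffun_upd (V X : finType) (phi : {ffun V -> X}) u x : {ffun V -> X} :=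
  [ffun w => if w == u then x else phi w].

(** Exchanging [x] with [phi u] is an involution on pairs [(phi, x)]. As [F] does not see the value
    at [u], [phi u] is as good as a fresh uniform colour. *)
Lemma sum_resample (V X : finType) (u : V) (F : {ffun V -> X} -> X -> nat) :
  (forall phi x y, F (ffun_upd phi u y) x = F phi x) ->
  \sum_phi \sum_x F phi x = #|X| * \sum_phi F phi (phi u).
Proof.
move=> Fu; rewrite pair_big /=.
pose s (p : {ffun V -> X} * X) := (ffun_upd p.1 u p.2, p.1 u).
have sK : involutive s.
  move=> [phi x]; rewrite /s /= ffunE eqxx; congr (_, _).
  by apply/ffunP => w; rewrite !ffunE; case: eqP => // ->.
rewrite (reindex_inj (inv_inj sK)) /=.
under eq_bigr do rewrite Fu.
rewrite -(pair_big predT predT (fun (phi : {ffun V -> X}) (_ : X) => F phi (phi u))) /=.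
by rewrite big_distrr /=; apply: eq_bigr => phi _; rewrite sum_nat_const.
Qed.

Section Colorings.
Variables (V Y Z : finType) (e : rel V).
Hypotheses (e_sym : symmetric e) (e_irr : irreflexive e).
Local Notation X := (Y * Z)%type.
Local Notation coloring := {ffun V -> X}.
Implicit Types (phi psi : coloring) (S : {set V}).

(* Colourings of all of [V], constrained only on [S]: the values off [S] are
   free, so each vertex added to [S] may be resampled uniformly. *)
Definition colorings S : {set coloring} :=
  [set phi : coloring | [forall u in S, forall w in S, e u w ==> (phi u != phi w)]].

Definition avail S u phi : {set X} :=
  [set x : X | [forall w in S, e u w ==> (phi w != x)]].

Lemma coloringsP S phi :
  reflect {in S &, forall u w, e u w -> phi u != phi w} (phi \in colorings S).
Proof.
rewrite inE; apply: (iffP forall_inP) => [H u w uS wS|H u uS].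
  by have /forall_inP/(_ w wS)/implyP := H u uS.
by apply/forall_inP => w wS; apply/implyP; apply: H.
Qed.

Lemma availP S u phi x :
  reflect {in S, forall w, e u w -> phi w != x} (x \in avail S u phi).
Proof.
rewrite inE; apply: (iffP forall_inP) => [H w wS|H w wS].
  by have /implyP := H w wS.
by apply/implyP; apply: H.
Qed.

Lemma avail_setU1 S u phi : avail (u |: S) u phi = avail S u phi.
Proof.
apply/setP => x; apply/availP/availP => H w wS.
  by apply: H; rewrite inE wS orbT.
by move: wS; rewrite !inE => /predU1P[->|/H //]; rewrite e_irr.
Qed.

Lemma colorings_setU1 S u phi : (phi \in colorings (u |: S)) =
  (phi \in colorings S) && (phi u \in avail S u phi).
Proof.
apply/coloringsP/andP => [H|[/coloringsP HS /availP Hu] a b].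
  split; first by apply/coloringsP => a b aS bS; apply: H; rewrite inE ?aS ?bS orbT.
  apply/availP => w wS uw; rewrite eq_sym; apply: H => //; first exact: setU11.
  by rewrite inE wS orbT.
rewrite !inE => /predU1P[->|aS] /predU1P[->|bS]; first by rewrite e_irr.
- by rewrite eq_sym; apply: Hu.
- by rewrite e_sym; apply: Hu.
- exact: HS.
Qed.

Lemma colorings_upd S u phi x : u \notin S ->
  (ffun_upd phi u x \in colorings S) = (phi \in colorings S).
Proof.
move=> uS; have E w : w \in S -> ffun_upd phi u x w = phi w.
  by move=> wS; rewrite ffunE; case: eqP => // wu; rewrite -wu wS in uS.
by apply/coloringsP/coloringsP => H a b aS bS /(H a b aS bS); rewrite !E.
Qed.

Lemma avail_upd S v u phi x : u \notin S ->
  avail S v (ffun_upd phi u x) = avail S v phi.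
Proof.
move=> uS; have E w : w \in S -> ffun_upd phi u x w = phi w.
  by move=> wS; rewrite ffunE; case: eqP => // wu; rewrite -wu wS in uS.
by apply/setP => y; apply/availP/availP => H w wS /(H w wS); rewrite E.
Qed.

Lemma count_resample S u (E : coloring -> pred X) : u \notin S ->
  (forall phi x y, E (ffun_upd phi u y) x = E phi x) ->
  #|{: X}| * #|[set phi : coloring in colorings S | E phi (phi u)]| =
  \sum_(phi in colorings S) #|[set x | E phi x]|.
Proof.
move=> uS Eu.
pose F phi x : nat := (phi \in colorings S) && E phi x.
have FE phi x y : F (ffun_upd phi u y) x = F phi x.
  by rewrite /F colorings_upd // Eu.
rewrite -sum1_card big_mkcond /= (eq_bigr (fun phi => F phi (phi u))); last first.
  by move=> phi _; rewrite inE /F; case: (_ && _).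
rewrite -(sum_resample FE) [RHS]big_mkcond; apply: eq_bigr => phi _.
rewrite /F; case: (phi \in _) => /=; last by rewrite big1.
by rewrite -sum1_card [RHS]big_mkcond; apply: eq_bigr => x _; rewrite inE; case: (E _ _).
Qed.

(** Off the domain values are free, so adding [u] multiplies the count by the average of
    [#|avail S u phi|] divided by [#|{: X}|]. *)
Lemma card_colorings_setU1 S u : u \notin S ->
  #|{: X}| * #|colorings (u |: S)| = \sum_(phi in colorings S) #|avail S u phi|.
Proof.
move=> uS; rewrite (eq_bigr (fun phi => #|[set x | x \in avail S u phi]|)).
  rewrite -(count_resample (u := u) (E := fun phi x => x \in avail S u phi)) //.
    by congr (_ * #|pred_of_set _|); apply/setP => phi; rewrite [RHS]in_set colorings_setU1.
  by move=> phi x y; rewrite avail_upd.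
by move=> phi _; apply: eq_card => x; rewrite inE.
Qed.

(** Dropping the constraint at [u] enlarges the set and makes [phi u] uniform; then [#|Z|] colours
    share the part of [phi w]. *)
Lemma count_same_part S u w : u \notin S -> w != u ->
  #|{: X}| * #|[set phi : coloring in colorings (u |: S) | (phi w).1 == (phi u).1]|
  <= #|Z| * #|colorings S|.
Proof.
move=> uS wu.
apply: (@leq_trans (#|{: X}| * #|[set phi : coloring in colorings S | (phi w).1 == (phi u).1]|)).
  rewrite leq_mul2l; apply/orP; right; apply: subset_leq_card.
  apply/subsetP => phi /setIdP[]; rewrite colorings_setU1 => /andP[phiS _] E.
  by apply/setIdP.
rewrite (count_resample (E := fun phi x => (phi w).1 == x.1)) //; last first.
  by move=> phi x y; rewrite ffunE (negPf wu).
rewrite mulnC -sum_nat_const; apply: leq_sum => phi _.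
rewrite (_ : [set x | _] = setX [set (phi w).1] [set: Z]).
  by rewrite cardsX cards1 mul1n cardsT.
by apply/setP => -[y z]; rewrite !inE /= andbT eq_sym.
Qed.

Definition part_avail S u phi : {set X} :=
  [set x in avail S u phi | x.1 == (phi u).1].

(** A part with at most one available colour offers at most one bad value for [phi u], hence at most
    [#|Y|] bad values in all. *)
Lemma count_short_part S u : u \notin S ->
  #|{: X}| * #|[set phi : coloring in colorings (u |: S) | #|part_avail (u |: S) u phi| <= 1]|
  <= #|Y| * #|colorings S|.
Proof.
move=> uS.
pose E phi (x : X) := (x \in avail S u phi) &&
  (#|[set y in avail S u phi | y.1 == x.1]| <= 1).
rewrite (_ : [set _ in _ | _] = [set phi : coloring in colorings S | E phi (phi u)]); last first.
  apply/setP => phi; rewrite [LHS]in_set [RHS]in_set /E /part_avail avail_setU1.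
  by rewrite colorings_setU1 andbA.
rewrite count_resample //; last by move=> phi x y; rewrite /E avail_upd.
rewrite mulnC -sum_nat_const; apply: leq_sum => phi _.
rewrite -(card_in_imset (f := fst)); first exact: max_card.
move=> x y; rewrite !inE => /andP[xa x1] /andP[ya _] xy.
apply/eqP; apply: contraLR x1 => nxy; rewrite -ltnNge; apply/card_gt1P.
by exists x, y; split=> //; rewrite in_set ?xa ?ya ?xy eqxx.
Qed.

End Colorings.

Arguments colorings {V Y Z} e S.

(** * Resampling shades in the neighbourhood of a vertex *)

Section Resampling.
Variables (V Y Z : finType) (e : rel V).
Hypotheses (e_sym : symmetric e) (e_irr : irreflexive e).
Local Notation X := (Y * Z)%type.
Local Notation coloring := {ffun V -> X}.
Local Notation cols := (@colorings V Y Z e).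
Variables (S : {set V}) (v : V).
Implicit Types phi psi : coloring.

Definition nbrs_in : {set V} := [set u in S | e v u].

Definition isolated phi : {set V} :=
  [set u in nbrs_in | [forall w in nbrs_in, e u w ==> ((phi w).1 != (phi u).1)]].

(* Adjacent isolated vertices carry different parts, so, once the parts and the
   colours off [isolated phi] are fixed, their colours are independent: the
   colourings compatible with these data are exactly
   [family (resample_list phi)]. *)
Definition resample_list phi u : {set X} :=
  if u \in isolated phi then part_avail e S u phi else [set phi u].

Definition resample_class phi : {set coloring} :=
  [set psi | psi \in family (resample_list phi)].

Lemma nbrs_inS u : u \in nbrs_in -> u \in S.
Proof. by rewrite inE => /andP[]. Qed.

Lemma isolatedP phi u w : u \in isolated phi -> w \in nbrs_in -> e u w ->
  (phi w).1 != (phi u).1.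
Proof. by rewrite inE => /andP[_ /forall_inP H] wN; apply/implyP/H. Qed.

Lemma isolated_nbr phi u : u \in isolated phi -> u \in nbrs_in.
Proof. by rewrite inE => /andP[]. Qed.

Lemma resample_classP phi psi :
  reflect (forall u, psi u \in resample_list phi u) (psi \in resample_class phi).
Proof. by rewrite inE; apply: familyP. Qed.

Lemma resample_list_refl phi u :
  phi \in cols S -> phi u \in resample_list phi u.
Proof.
move=> /coloringsP phiS; rewrite /resample_list.
case: ifP => [uI|_]; last by rewrite inE.
rewrite inE eqxx andbT; apply/availP => w wS uw; rewrite eq_sym.
by apply: phiS => //; apply/nbrs_inS/(isolated_nbr uI).
Qed.

Lemma resample_class_out phi psi u : psi \in resample_class phi ->
  u \notin isolated phi -> psi u = phi u.
Proof.
by move=> /resample_classP/(_ u) + uI; rewrite /resample_list (negPf uI) => /set1P.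
Qed.

Lemma resample_class_in phi psi u : psi \in resample_class phi ->
  u \in isolated phi -> psi u \in avail e S u phi.
Proof.
by move=> /resample_classP/(_ u) + uI; rewrite /resample_list uI => /setIdP[].
Qed.

Lemma resample_class_part phi psi u : psi \in resample_class phi ->
  (psi u).1 = (phi u).1.
Proof.
move=> /resample_classP/(_ u); rewrite /resample_list.
by case: ifP => _ => [/setIdP[_ /eqP]|/set1P->].
Qed.

Lemma resample_class_isolated phi psi : psi \in resample_class phi ->
  isolated psi = isolated phi.
Proof.
move=> psiC; apply/setP => u; rewrite !in_set; congr (_ && _).
by apply: eq_forallb => w; rewrite !(resample_class_part _ psiC).
Qed.

Lemma resample_class_colorings phi psi : phi \in cols S ->
  psi \in resample_class phi -> psi \in cols S.
Proof.
move=> /coloringsP phiS psiC.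
(* Two adjacent isolated vertices keep their distinct parts; if [w] is not isolated, its colour is
   kept and the list of [u] avoids it. *)
have half u w : u \in S -> w \in S -> e u w -> u \in isolated phi -> psi w != psi u.
  move=> uS wS uw uI; case: (boolP (w \in isolated phi)) => wI.
    apply: contra_neq (isolatedP uI (isolated_nbr wI) uw) => E.
    by rewrite -!(resample_class_part _ psiC) E.
  rewrite (resample_class_out psiC wI).
  by have /availP := resample_class_in psiC uI; apply.
apply/coloringsP => u w uS wS uw.
case: (boolP (u \in isolated phi)) => uI; first by rewrite eq_sym; apply: half.
case: (boolP (w \in isolated phi)) => wI; first by apply: half; rewrite // e_sym.
by rewrite !(resample_class_out psiC) //; apply: phiS.
Qed.

(** A resampled neighbour stays within its part, which differs from that of an isolated [u], so the
    colours available in the part of [u] do not change. Hence the classes form a partition. *)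
Lemma resample_class_list phi psi u : psi \in resample_class phi ->
  resample_list psi u = resample_list phi u.
Proof.
move=> psiC; rewrite /resample_list (resample_class_isolated psiC).
case: (boolP (u \in isolated phi)) => uI; last by rewrite (resample_class_out psiC uI).
apply/setP => x; rewrite /part_avail 2!in_set (resample_class_part _ psiC).
case: (boolP (x.1 == (phi u).1)) => [/eqP xu|]; rewrite ?andbF // !andbT.
have E w : w \in S -> e u w -> (psi w != x) = (phi w != x).
  move=> wS uw; case: (boolP (w \in isolated phi)) => wI.
    have pw := isolatedP uI (isolated_nbr wI) uw.
    transitivity true; last symmetry; apply: contra_neq pw => wx.
      by rewrite -(resample_class_part _ psiC) wx.
    by rewrite wx.
  by rewrite (resample_class_out psiC wI).
by apply/availP/availP => H w wS uw; move: (H w wS uw); rewrite E.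
Qed.

Lemma resample_class_eq phi psi : psi \in resample_class phi ->
  resample_class psi = resample_class phi.
Proof.
move=> psiC; apply/setP => xi.
by apply/resample_classP/resample_classP => H u; move: (H u); rewrite (resample_class_list u psiC).
Qed.

Definition blocked phi : {set V} :=
  [set u in nbrs_in | #|resample_list phi u| <= 1].

(** A list is short for one of two reasons: an adjacent neighbour shares the part of [u], or that
    part has at most one available colour. *)
Lemma card_blocked_le phi :
  #|blocked phi| <= \sum_(u in nbrs_in)
    (\sum_(w in nbrs_in | e u w) ((phi w).1 == (phi u).1)
     + (#|part_avail e S u phi| <= 1)).
Proof.
rewrite -sum1_card (eq_bigl (fun u => (u \in nbrs_in) && (u \in blocked phi))); last first.
  by move=> u; apply/idP/andP => [uB|[]//]; split=> //; case/setIdP: uB.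
rewrite big_mkcondr; apply: leq_sum => u uN.
case: ifP => //; rewrite in_set uN /= /resample_list.
case: ifP => [_ ->|+ _]; first by rewrite addn1.
rewrite in_set uN => /negbT; rewrite negb_forall_in => /existsP[w /andP[wN]].
rewrite negb_imply => /andP[uw /negPn E].
by rewrite (bigD1 w) ?wN //= E.
Qed.

Variable R : realType.
Local Open Scope ring_scope.
Variable lam : R.
Hypothesis lam_gt0 : 0 < lam.
Hypothesis X_gt0 : (0 < #|{: X}|)%N.
Hypothesis IH : forall u, u \in S ->
  lam * #|cols (S :\ u)|%:R <= #|{: X}|%:R * #|cols S|%:R.

(** Union bound over the two causes of blocking. An event counted by [m] colours out of [#|{: X}|]
    over [S :\ u] gets, through [IH], probability at most [m / lam] over [S]. *)
Lemma sum_blocked_le :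
  lam * \sum_(phi in cols S) #|blocked phi|%:R <=
  ((\sum_(u in nbrs_in) #|[set w in nbrs_in | e u w]|)%:R * #|Z|%:R
   + #|nbrs_in|%:R * #|Y|%:R) * #|cols S|%:R.
Proof.
set P := cols S.
have key u m (A : {set coloring}) : u \in S ->
    (#|{: X}| * #|A| <= m * #|cols (S :\ u)|)%N ->
    lam * #|A|%:R <= m%:R * #|P|%:R.
  move=> uS; rewrite -(ler_nat R) !natrM => H.
  rewrite -(ler_pM2l (x := #|{: X}|%:R)) ?ltr0n // mulrCA.
  apply: le_trans (ler_wpM2l (ltW lam_gt0) H) _.
  rewrite mulrCA [X in _ <= X]mulrCA; apply: ler_wpM2l => //.
  exact: IH.
have same u w : u \in S -> e u w ->
    lam * #|[set phi : coloring in P | (phi w).1 == (phi u).1]|%:R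
    <= #|Z|%:R * #|P|%:R.
  move=> uS uw; apply: (key u) => //; rewrite /P -{1}(setD1K uS).
  apply: count_same_part => //; first by rewrite !inE eqxx.
  by apply: contraTneq uw => ->; rewrite e_irr.
have short u : u \in S ->
    lam * #|[set phi : coloring in P | (#|part_avail e S u phi| <= 1)%N]|%:R
    <= #|Y|%:R * #|P|%:R.
  move=> uS; apply: (key u) => //; rewrite /P.
  have := @count_short_part V Y Z e e_sym e_irr (S :\ u) u.
  by rewrite (setD1K uS); apply; rewrite !inE eqxx.
have ind (E : pred coloring) :
    (\sum_(phi in P) E phi)%N = #|[set phi in P | E phi]|.
  rewrite -sum1_card big_mkcond [RHS]big_mkcond; apply: eq_bigr => phi _.
  by rewrite [in RHS]in_set; case: (phi \in P); case: (E phi).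
have le1 : (\sum_(phi in P) #|blocked phi| <= \sum_(u in nbrs_in)
    (\sum_(w in nbrs_in | e u w) #|[set phi : coloring in P | (phi w).1 == (phi u).1]|
     + #|[set phi : coloring in P | (#|part_avail e S u phi| <= 1)%N]|))%N.
  apply: leq_trans (leq_sum _ (fun phi _ => card_blocked_le phi)) _.
  rewrite exchange_big /=; apply: leq_sum => u uN; rewrite big_split /= ind leq_add2r.
  by rewrite exchange_big /=; apply: leq_sum => w wN; rewrite ind.
move: le1; rewrite -(ler_nat R) => le1.
rewrite -natr_sum; apply: le_trans (ler_wpM2l (ltW lam_gt0) le1) _.
rewrite natr_sum mulr_sumr mulrDl natr_sum !mulr_suml.
rewrite -[#|nbrs_in|]sum1_card natr_sum !mulr_suml -big_split /=.
apply: ler_sum => u uN; have uS := nbrs_inS uN.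
rewrite natrD mulrDr lerD ?mul1r ?short //.
rewrite natr_sum mulr_sumr -sum1_card natr_sum !mulr_suml.
rewrite [leRHS](eq_bigl (fun w => (w \in nbrs_in) && e u w)) => [|w]; last by rewrite in_set.
by apply: ler_sum => w /andP[_ uw]; rewrite mul1r; apply: same.
Qed.

Lemma card_colorings_step (D T : R) :
  v \notin S -> 0 <= D ->
  #|[set u | e v u]|%:R <= D ->
  (\sum_(u | e v u) #|[set w | e v w && e u w]|)%:R <= T ->
  lam <= #|{: X}|%:R / 2 * expR (- (4 * D / #|{: X}|%:R)) ->
  T * #|Z|%:R + D * #|Y|%:R <= lam * (#|{: X}|%:R / 2) ->
  lam * #|cols S|%:R <= #|{: X}|%:R * #|cols (v |: S)|%:R.
Proof.
set q : R := #|{: X}|%:R; move=> vS D0 vD vT lam_le bad_le.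
have q0 : 0 < q by rewrite ltr0n.
(* With this [th], once at most [q / 2] colours are lost to blocking on average, the gain
   [q / 2 * th] cancels the loss [2 * D] exactly. *)
pose th := 4 * D / q; have th0 : 0 <= th by rewrite divr_ge0 ?mulr_ge0 // ltW.
have ND : #|nbrs_in|%:R <= D.
  apply: le_trans vD; rewrite ler_nat; apply: subset_leq_card.
  by apply/subsetP => u; rewrite !inE => /andP[].
have NT : (\sum_(u in nbrs_in) #|[set w in nbrs_in | e u w]|)%:R <= T.
  apply: le_trans vT; rewrite ler_nat big_mkcond [X in (_ <= X)%N]big_mkcond /=.
  apply: leq_sum => u _; rewrite inE; case: (u \in S) => //=; case: ifP => // _.
  apply: subset_leq_card; apply/subsetP => w; rewrite !inE.
  by move=> /andP[/andP[_ ->] ->].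
set P := cols S.
have Bsum : \sum_(phi in P) #|blocked phi|%:R <= q / 2 * #|P|%:R.
  rewrite -(ler_pM2l lam_gt0); apply: le_trans sum_blocked_le _.
  rewrite [X in _ <= X]mulrA; apply: ler_wpM2r => //; apply: le_trans bad_le.
  by apply: lerD; apply: ler_wpM2r.
rewrite -natrM card_colorings_setU1 // natr_sum.
rewrite (@sum_class_average _ _ P resample_class); first last.
- move=> phi psi phiP psiC; split; first exact: resample_class_colorings psiC.
  exact: resample_class_eq.
- by move=> phi phiP; apply/resample_classP => u; apply: resample_list_refl.
apply: (@le_trans _ _ (\sum_(phi in P)
   expR (- th) * ((q - #|blocked phi|%:R) * (1 + th) - 2 * D))); last first.
  apply: ler_sum => phi phiP.
  have F0 u : (0 < #|resample_list phi u|)%N.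
    by apply/card_gt0P; exists (phi u); apply: resample_list_refl.
  have := @family_avoid_average R V _ nbrs_in (resample_list phi) th th0 F0.
  rewrite -/(blocked phi) => avg.
  have -> : (\sum_(psi in resample_class phi) #|avail e S v psi|%:R)
      / #|resample_class phi|%:R =
    (\sum_(psi in family (resample_list phi))
      #|[set c | [forall u in nbrs_in, psi u != c]]|%:R)
      / #|family (resample_list phi)|%:R :> R.
    congr (_ / _%:R); last by apply: eq_card => psi; rewrite inE.
    apply: eq_big => [psi|psi _]; first by rewrite inE.
    congr (_%:R); apply: eq_card => c; rewrite [RHS]in_set.
    apply/availP/forall_inP => [H u|H w wS vw]; first by rewrite inE => /andP[]; apply: H.
    by apply: H; rewrite inE wS.
  apply: le_trans avg; apply: ler_wpM2l; first exact: expR_ge0.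
  by rewrite lerD2l lerN2 ler_pM2l.
rewrite -mulr_sumr sumrB -mulr_suml sumrB !sumr_const.
set b := \sum_(_ in _) _ in Bsum *.
rewrite -[q *+ _]mulr_natr -[(2 * D) *+ _]mulr_natr.
apply: (@le_trans _ _ (expR (- th) * (q / 2 * #|P|%:R))).
  by rewrite mulrA [expR _ * _]mulrC; apply: ler_wpM2r.
apply: ler_wpM2l; first exact: expR_ge0.
have qth : q * th = 4 * D by rewrite /th mulrC divfK ?gt_eqF.
have -> : q / 2 * #|P|%:R
   = (q * #|P|%:R - q / 2 * #|P|%:R) * (1 + th) - 2 * D * #|P|%:R.
  have -> : D = q * th / 4 by rewrite qth; field.
  by field.
by rewrite lerD2r; apply: ler_wpM2r; rewrite ?addr_ge0 // lerD2l lerN2.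
Qed.

End Resampling.

Theorem locally_sparse_coloring (R : realType) (V Y Z : finType) (e : rel V)
    (lam D T : R) :
  symmetric e -> irreflexive e -> (0 < #|Y|)%N -> (0 < #|Z|)%N ->
  (0 < lam)%R -> (0 <= D)%R ->
  (forall v, #|[set u | e v u]|%:R <= D)%R ->
  (forall v, (\sum_(u | e v u) #|[set w | e v w && e u w]|)%:R <= T)%R ->
  (lam <= #|{: Y * Z}|%:R / 2 * expR (- (4 * D / #|{: Y * Z}|%:R)))%R ->
  (T * #|Z|%:R + D * #|Y|%:R <= lam * (#|{: Y * Z}|%:R / 2))%R ->
  exists h : V -> Y * Z, forall u w, e u w -> h u != h w.
Proof.
move=> e_sym e_irr Y0 Z0 lam0 D0 degD nbrT lam_le bad_le.
have X0 : 0 < #|{: Y * Z}| by rewrite card_prod muln_gt0 Y0.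
(* The step at [S] needs the ratio at every [S :\ u], so the induction is on [#|S|] with [S] and [v]
   free. *)
have step n (S : {set V}) v : #|S| = n -> v \notin S ->
    (lam * #|colorings (Y := Y) (Z := Z) e S|%:R
     <= #|{: Y * Z}|%:R * #|colorings (Y := Y) (Z := Z) e (v |: S)|%:R)%R.
  elim: n S v => [|n IHn] S v Sn vS;
    apply: (card_colorings_step e_sym e_irr lam0 X0 _ vS D0) => // u uS.
    by rewrite (cards0_eq Sn) inE in uS.
  rewrite -{2}(setD1K uS); apply: IHn; last by rewrite !inE eqxx.
  by have := cardsD1 u S; rewrite uS Sn; lia.
have pos (S : {set V}) : 0 < #|colorings (Y := Y) (Z := Z) e S|.
  elim: {S}#|S| {-2}S (erefl #|S|) => [|n IHn] S Sn.
    have /card_gt0P[x _] := X0.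
    apply/card_gt0P; exists [ffun=> x]; apply/coloringsP => u w.
    by rewrite (cards0_eq Sn) inE.
  have [u uS] : exists u, u \in S by apply/card_gt0P; rewrite Sn.
  have S'n : #|S :\ u| = n by have := cardsD1 u S; rewrite uS Sn; lia.
  have := step _ (S :\ u) u (erefl _).
  rewrite (setD1K uS) !inE eqxx /= => /(_ isT) H.
  rewrite -(ltr_nat R); rewrite -(pmulr_rgt0 (x := #|{: Y * Z}|%:R)) ?ltr0n //.
  by apply: lt_le_trans H; rewrite mulr_gt0 // ltr0n IHn.
have /card_gt0P[h /coloringsP hP] := pos [set: V].
by exists h => u w; apply: hP; rewrite inE.
Qed.

(** * The bound on the two-tone chromatic number *)

Local Open Scope ring_scope.

Lemma nat_ge_near (R : realType) (y : R) : 0 <= y ->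
  exists2 n : nat, y <= n%:R & n%:R <= y + 1.
Proof.
move=> /truncn_itv /andP[le lt]; exists (Num.truncn y).+1; first exact: ltW.
by rewrite -natr1 lerD2r.
Qed.

Lemma tau2_le_sparse (R : realType) (G : sgraph) (f : R) :
  1 < f -> f <= (max_degree G)%:R ^+ 4 -> ln f <= (max_degree G)%:R ^+ 2 ->
  (forall u : G, #|dist2_pairs u|%:R <= (max_degree G)%:R ^+ 4 / f) ->
  (tau2 G)%:R <= (chromatic_number G)%:R *
      (1 + 92 * (max_degree G)%:R / Num.sqrt (ln f)).
Proof.
set d : R := (max_degree G)%:R => f1 fd Ld pairs.
have f0 : 0 < f by apply: lt_trans f1.
pose L := ln f; have L0 : 0 < L by apply: ln_gt0.
(* [x] is the eighth root of [f]. There will be about [x ^ 2] shades and [y] parts; both are at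
   least 1, so rounding up at most doubles each. *)
pose x := expR (L / 8).
have x0 : 0 < x by apply: expR_gt0.
have x1 : 1 < x by rewrite expR_gt1; lra.
have fx : f = x ^+ 8.
  rewrite /x -expRM_natr divfK ?pnatr_eq0 //; apply/esym/lnK; exact: f0.
have L8x : L <= 8 * x.
  have -> : L = 8 * ln x by rewrite /x expRK; field.
  by rewrite ler_pM2l // ltW // ln_sublinear.
have d0 : 0 <= d by [].
have x2d : x ^+ 2 <= d.
  rewrite -(ler_pXn2r (n := 4)) ?nnegrE ?exprn_ge0 ?(ltW x0) // -exprM.
  by move: fd; rewrite fx.
have dgt0 : 0 < d by apply: lt_le_trans x2d; rewrite exprn_gt0.
have xx2 : x <= x ^+ 2 by rewrite expr2 ler_peMr // ltW.
have L8d : L <= 8 * d by lra.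
have Lx2 : L * x ^+ 2 <= 8 * d ^+ 2.
  rewrite [d ^+ 2]expr2 mulrA; apply: ler_pM => //; first exact: ltW.
  by rewrite exprn_ge0 // ltW.
have Lx20 : 0 < L * x ^+ 2 by rewrite mulr_gt0 // exprn_gt0.
have [q0 q0_ge q0_le] := @nat_ge_near R (x ^+ 2) (exprn_ge0 _ (ltW x0)).
pose y := 256 * d ^+ 2 / (L * x ^+ 2).
have y1 : 1 <= y by rewrite ler_pdivlMr // mul1r; nra.
have [k k_ge k_le] := @nat_ge_near R y (le_trans ler01 y1).
have x21 : 1 <= x ^+ 2 by rewrite expr_ge1 // ltW.
pose q : R := k%:R * q0%:R.
have q_ge : 256 * d ^+ 2 / L <= q.
  apply: (@le_trans _ _ (y * x ^+ 2)).
    by rewrite /y le_eqVlt; apply/orP; left; apply/eqP; field; rewrite !gt_eqF.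
  by apply: ler_pM => //; [lra | rewrite exprn_ge0 // ltW].
have q_le : q <= 1024 * d ^+ 2 / L.
  apply: (@le_trans _ _ ((2 * y) * (2 * x ^+ 2))).
    by apply: ler_pM => //; lra.
  by rewrite /y le_eqVlt; apply/orP; left; apply/eqP; field; rewrite !gt_eqF.
have q_gt0 : 0 < q.
  by apply: lt_le_trans q_ge; rewrite divr_gt0 // mulr_gt0 // exprn_gt0.
have cardq : #|{: 'I_k * 'I_q0}|%:R = q by rewrite card_prod !card_ord natrM.
have qL : 256 * d ^+ 2 <= q * L by rewrite -ler_pdivrMr.
have qx : 32 * d ^+ 2 <= q * x.
  have : q * L <= q * (8 * x) by rewrite ler_pM2l.
  by lra.
have [h hP] : exists h : G -> 'I_k * 'I_q0, forall u w,
    gdist u w == Some 2 -> h u != h w.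
  (* Here [lam] is [q / (2 * x)]: by [qL], the factor [expR (- (4 * D / q))] is at least
     [expR (- (L / 8))], the inverse of [x]. *)
  apply: (@locally_sparse_coloring R G 'I_k 'I_q0 _ (q / 2 / x) (d ^+ 2)
    (2 * d ^+ 4 / f) (@gdist2_sym G)).
  - by move=> u; rewrite gdistxx.
  - by rewrite card_ord -(ltr_nat R); lra.
  - by rewrite card_ord -(ltr_nat R); lra.
  - by rewrite !divr_gt0.
  - by rewrite exprn_ge0.
  - by move=> u; rewrite -natrX ler_nat card_gdist2_le.
  - move=> u; apply: (@le_trans _ _ (2 * #|dist2_pairs u|%:R)).
      by rewrite -natrM ler_nat card_dist2_ordered_pairs.
    by rewrite -mulrA ler_pM2l.
  - rewrite cardq -expRN; apply: ler_wpM2l; first by rewrite divr_ge0 // ltW.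
    rewrite ler_expR lerN2 ler_pdivrMr //; nra.
  - rewrite cardq !card_ord.
    have xi0 : 0 < x^-1 by rewrite invr_gt0.
    (* The budget [q ^ 2 / (4 * x)] is halved: one half pays for adjacent neighbours sharing a part,
       the other for parts with at most one available colour. *)
    have E : q / 2 / x * (q / 2) = (q * x) ^+ 2 / 8 / x ^+ 3 + (q * x) * q / (8 * x ^+ 2).
      by field; rewrite gt_eqF.
    rewrite E; apply: lerD.
      apply: (@le_trans _ _ (2 * d ^+ 4 / x ^+ 8 * (2 * x ^+ 2))).
        rewrite fx; apply: ler_wpM2l; last by lra.
        by rewrite divr_ge0 ?mulr_ge0 ?exprn_ge0 // ltW.
      have -> : 2 * d ^+ 4 / x ^+ 8 * (2 * x ^+ 2) = 4 * d ^+ 4 / x ^+ 3 / x ^+ 3.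
        by field; rewrite gt_eqF.
      rewrite [X in _ <= X]mulrAC.
      apply: (@le_trans _ _ (4 * d ^+ 4 / x ^+ 3)).
        rewrite ler_pdivrMr ?exprn_gt0 // ler_peMr ?expr_ge1 ?(ltW x1) //.
          by rewrite divr_ge0 ?mulr_ge0 ?exprn_ge0 // ltW.
        exact: ltW.
      rewrite ler_pdivlMr // [X in X <= _]mulrAC ler_pM2r ?invr_gt0 ?exprn_gt0 //.
      have : (32 * d ^+ 2) ^+ 2 <= (q * x) ^+ 2.
        by rewrite ler_pXn2r // nnegrE; [rewrite mulr_ge0 ?exprn_ge0 | rewrite mulr_ge0 // ltW].
      have : 0 <= d ^+ 4 by rewrite exprn_ge0.
      have -> : (32 * d ^+ 2) ^+ 2 = 1024 * d ^+ 4 by ring.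
      by lra.
    rewrite ler_pdivlMr ?mulr_gt0 ?exprn_gt0 //.
    apply: (@le_trans _ _ (d ^+ 2 * k%:R * (8 * q0%:R))).
      apply: ler_wpM2l; last by lra.
      by rewrite mulr_ge0 // exprn_ge0.
    have -> : d ^+ 2 * k%:R * (8 * q0%:R) = (8 * d ^+ 2) * q by rewrite /q; ring.
    have d20 : 0 <= d ^+ 2 by rewrite exprn_ge0.
    by rewrite ler_pM2r //; lra.
pose s := Num.sqrt L.
have s0 : 0 < s by rewrite sqrtr_gt0.
have sL : s ^+ 2 = L by rewrite sqr_sqrtr // ltW.
(* As [46 ^ 2 = 2116] exceeds [2 * 1024], any [r >= z] has [r ^ 2 >= 2 * q]. The palette size [r.+1]
   yields the summand 1, and [r <= 2 * z] the constant 92. *)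
pose z := 46 * d / s.
have z1 : 1 <= z.
  rewrite ler_pdivlMr // mul1r.
  apply: (@le_trans _ _ d); last by lra.
  by rewrite -(ler_pXn2r (n := 2)) ?nnegrE ?(ltW s0) // sL.
have [r r_ge r_le] := @nat_ge_near R z (le_trans ler01 z1).
have qr : (#|{: 'I_k * 'I_q0}| <= 'C(r.+1, 2))%N.
  have : (2 * #|{: 'I_k * 'I_q0}| <= r ^ 2)%N.
    rewrite -(ler_nat R) natrM natrX cardq.
    apply: (@le_trans _ _ (z ^+ 2)); last first.
      by rewrite ler_pXn2r ?nnegrE // (le_trans ler01).
    have -> : z ^+ 2 = 2116 * (d ^+ 2 / L).
      by rewrite /z -sL; field; rewrite gt_eqF.
    have : 0 <= d ^+ 2 / L by rewrite divr_ge0 ?exprn_ge0 // ltW.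
    by move: q_le; rewrite -mulrA; lra.
  rewrite bin2 /= geq_half_double -mul2n => /leq_trans; apply.
  by rewrite -mulnn leq_mul2r leqnSn orbT.
have := tau2_le_chromatic_mul hP qr; rewrite -(ler_nat R) natrM => le.
apply: le_trans le _; apply: ler_wpM2l => //; rewrite -natr1 addrC lerD2l.
apply: (le_trans r_le); have -> : 92 * d / s = 2 * z by rewrite /z; field; rewrite gt_eqF.
by lra.
Qed.

(* The upper bound on f is not in the informal statement, which only asks for
   f > 1; without some such bound the claim fails (on complete graphs there are
   no pairs to count, so f could tend to infinity). *)
Theorem theorem1p13 (R : realType) :
  exists C : R, forall (G : sgraph) (f : R),
    1 < f ->
    f <= expR ((max_degree G)%:R ^+ 2) ->
    (forall u : G, #|dist2_pairs u|%:R <= (max_degree G)%:R ^+ 4 / f) ->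
    (tau2 G)%:R <= (chromatic_number G)%:R *
      (1 + C * (max_degree G)%:R / Num.sqrt (ln f)).
Proof.
exists 92 => G f f1 fe pairs.
have f0 : 0 < f by apply: lt_trans f1.
have L0 : 0 < ln f by apply: ln_gt0.
have Ld : ln f <= (max_degree G)%:R ^+ 2.
  by rewrite -ler_expR lnK.
have [fd|df] := leP f ((max_degree G)%:R ^+ 4).
  exact: tau2_le_sparse.
have s0 : 0 < Num.sqrt (ln f) by rewrite sqrtr_gt0.
have d0 : (0 < max_degree G)%N.
  by rewrite lt0n; apply: contraTneq Ld => ->; rewrite expr0n /= -ltNge.
have no (u : G) : dist2_pairs u = set0.
  have lt1 : #|dist2_pairs u|%:R < 1 :> R.
    by apply: le_lt_trans (pairs u) _; rewrite ltr_pdivrMr // mul1r.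
  by apply/eqP; rewrite -cards_eq0 -leqn0 -ltnS -(ltr_nat R).
have sd : Num.sqrt (ln f) <= (max_degree G)%:R.
  by rewrite -(ler_pXn2r (n := 2)) ?nnegrE ?(ltW s0) // sqr_sqrtr // ltW.
have t1 : 1 <= (max_degree G)%:R / Num.sqrt (ln f) by rewrite ler_pdivlMr // mul1r.
(* [5 * Delta] is at most 10 times the chromatic number, and [t1] makes [1 + 92 * t] exceed 10 for
   the ratio [t] bounded there. *)
apply: (@le_trans _ _ ((chromatic_number G)%:R * 10)).
  rewrite -natrM ler_nat; have := tau2_le_max_degree d0.
  by have := max_degree_le_chromatic d0 no; lia.
by apply: ler_wpM2l => //; rewrite -mulrA; lra.
Qed.
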